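(* Let $\gamma \geq 0$ be an integer and let $\mathrm{S}\subseteq \mathbb{N}$ be a $\gamma$-hyperelliptic numerical semigroup of genus $g \geq 2\gamma+1$. Then the $\mathrm{K}$-weight of $\mathrm{S}$ satisfies \[ \binom{g-2\gamma}{2}+ 2\gamma \;\leq\; W_{\mathrm{K}} \;\leq\; \binom{g-2\gamma}{2}+ 2\gamma^2. \]
   Context: A numerical semigroup $\mathrm{S}\subseteq\mathbb{N}$ is a submonoid of $(\mathbb{N},+)$ with finite complement; its genus is $g=|\mathbb{N}\setminus \mathrm{S}|$. Write the gaps as $\mathbb{N}\setminus\mathrm{S}=\{\ell_1,\dots,\ell_g\}$ with $\ell_1<\cdots<\ell_g$. The $\mathrm{K}$-weight of $\mathrm{S}$ is $W_{\mathrm{K}}:=\sum_{i=1}^{g-1}(\ell_i-i)+g-1$. For an integer $\gamma\ge 0$, $\mathrm{S}$ is called $\gamma$-hyperelliptic if (1) $\mathrm{S}$ contains exactly $\gamma$ even elements in the interval $[2,4\gamma]$, and (2) the $(\gamma+1)$-st positive element of $\mathrm{S}$ is $4\gamma+2$. *)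

(* Defs.v *)
From mathcomp Require Import all_boot all_order all_algebra finmap.
From mathcomp Require Import classical_sets cardinality.

Set Implicit Arguments.
Unset Strict Implicit.
Unset Printing Implicit Defensive.

Local Open Scope nat_scope.
Local Open Scope classical_set_scope.

Definition numerical_semigroup (S : set nat) : Prop :=
  [/\ S 0, forall m n, S m -> S n -> S (m + n) & finite_set (~` S)].

(* [fset_set A] is the empty set when [A] is infinite, so [genus] and [gaps] are
   meaningful only when [~` S] is finite. *)
Definition genus (S : set nat) : nat := #|` fset_set (~` S)|.

Definition gaps (S : set nat) : seq nat := sort leq (fset_set (~` S)).

(* 1-based: [gap S 1 < ... < gap S (genus S)] are the gaps of [S]. *)
Definition gap (S : set nat) (i : nat) : nat := nth 0 (gaps S) i.-1.

(* Valued in [int], so that no subtraction is truncated. *)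
Definition Kweight (S : set nat) : int :=
  (\sum_(1 <= i < genus S) ((gap S i)%:Z - i%:Z) + (genus S)%:Z - 1)%R.

(* [n] is the [k]-th positive element of [S], counting from 1. *)
Definition is_kth_positive (S : set nat) (k n : nat) : Prop :=
  [/\ S n, 0 < n & #|` fset_set [set m | S m /\ 0 < m <= n]| = k].

Definition hyperelliptic (gamma : nat) (S : set nat) : Prop :=
  #|` fset_set [set n | [/\ S n, ~~ odd n & 2 <= n <= 4 * gamma]]| = gamma
  /\ is_kth_positive S gamma.+1 (4 * gamma + 2).

(* Main.v *)
(** Split the gaps by parity: [2t] is a gap when [t] lies outside the semigroup
    [T = {t | 2t \in S}], and [2c+1] is a gap when [c] lies outside
    [M = {c | 2c+1 \in S}], which satisfies [M + T = M].  If [n] is not in [M]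
    and [y < n] is, then [n - y] is a gap of [T]; applied to [M = T] this shows
    that [T] has genus exactly [gamma], that its gaps are at most [2 gamma], and
    that they sum to at most [gamma ^ 2].  Applied to [M] shifted by its least
    element [m0], it bounds the number of elements of [M] below a gap [m0 + t]
    of [M] by the rank of [t] among the gaps of [T].  The largest gap of [S] is
    odd, and it is the one omitted from the K-weight, so only ranks below
    [gamma] contribute. *)
Require Import Defs.
From mathcomp Require Import all_boot all_order all_algebra finmap.
From mathcomp Require Import classical_sets cardinality.
From mathcomp Require Import zify.

Set Implicit Arguments.
Unset Strict Implicit.
Unset Printing Implicit Defensive.

Local Open Scope nat_scope.

(** * Counting the elements of a predicate below a bound *)

Definition nb (p : pred nat) (n : nat) : nat := count p (iota 0 n).

Lemma nbS p n : nb p n.+1 = nb p n + p n.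
Proof. by rewrite /nb -addn1 iotaD count_cat /= addn0. Qed.

Lemma nb_sum p n : nb p n = \sum_(0 <= i < n) p i.
Proof.
elim: n => [|n IHn]; first by rewrite big_geq.
by rewrite nbS big_nat_recr //= IHn.
Qed.

Lemma leq_nb p m n : m <= n -> nb p m <= nb p n.
Proof. by move=> /subnKC <-; rewrite /nb iotaD count_cat leq_addr. Qed.

Lemma nbC p n : nb p n + nb (predC p) n = n.
Proof. by rewrite /nb count_predC size_iota. Qed.

Lemma nb_predCK p n : nb (predC (predC p)) n = nb p n.
Proof. by apply: eq_count => i; rewrite /= negbK. Qed.

Lemma nb_stable (p : pred nat) m n :
  (forall i, m <= i -> ~~ p i) -> m <= n -> nb p n = nb p m.
Proof.
move=> p0 /subnKC <-; rewrite /nb iotaD count_cat -[RHS]addn0; congr (_ + _).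
apply/eqP; rewrite -leqn0 leqNgt -has_count; apply/hasPn => i.
by rewrite mem_iota => /andP[/p0].
Qed.

Lemma nb_pos (p : pred nat) i n : p i -> i < n -> 0 < nb p n.
Proof.
by move=> pi lt_in; rewrite -has_count; apply/hasP; exists i => //; rewrite mem_iota.
Qed.

Lemma sum_nat_condS (p : pred nat) (F : nat -> nat) n :
  \sum_(0 <= i < n.+1 | p i) F i =
  \sum_(0 <= i < n | p i) F i + (if p n then F n else 0).
Proof. by rewrite big_mkcond big_nat_recr //= -big_mkcond. Qed.

Lemma sum_parity (p : pred nat) (F : nat -> nat) n :
  \sum_(0 <= i < n.*2 | p i) F i =
  \sum_(0 <= i < n | p i.*2) F i.*2 + \sum_(0 <= i < n | p i.*2.+1) F i.*2.+1.
Proof.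
elim: n => [|n IHn]; first by rewrite !big_geq.
by rewrite doubleS !sum_nat_condS IHn -!addnA; congr (_ + _); rewrite addnCA.
Qed.

Lemma nb_parity p n :
  nb p n.*2 = nb (fun i => p i.*2) n + nb (fun i => p i.*2.+1) n.
Proof. by elim: n => [|n IHn] //; rewrite doubleS !nbS IHn; lia. Qed.

(** For [i] in [p], [nb p i.+1] is the rank of [i] in [p], so the sum is [1 + ... + nb p n]. *)
Lemma sum_nb_succ (p : pred nat) n :
  \sum_(0 <= i < n | p i) nb p i.+1 = 'C((nb p n).+1, 2).
Proof.
elim: n => [|n IHn]; first by rewrite big_geq.
rewrite sum_nat_condS IHn nbS.
by case: (p n); rewrite ?addn0 // addn1 [RHS]binS bin1.
Qed.

(* Each [i] counts the numbers below it; those satisfying [p] add up to a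
   binomial coefficient. *)
Lemma sum_nb_predC (p : pred nat) n :
  \sum_(0 <= i < n | p i) i =
  'C(nb p n, 2) + \sum_(0 <= i < n | p i) nb (predC p) i.
Proof.
elim: n => [|n IHn]; first by rewrite !big_geq.
rewrite !sum_nat_condS IHn nbS.
case: (p n); rewrite ?addn0 // addn1 binS bin1.
by have := nbC p n; lia.
Qed.

(** * Gaps of an additively closed set [t] and of a set stable under adding elements of [t] *)

(** The reflection [y |-> n - y] sends the elements of [q] below [n] to gaps of [t] in [[1, n]],
    whence the bound [n.+1]. *)
Lemma nb_shift_gaps (q t : pred nat) n :
  (forall y z, q y -> t z -> q (y + z)) -> ~~ q n -> nb q n <= nb (predC t) n.+1.
Proof.
move=> qt qn; rewrite !nb_sum big_nat_recl // big_nat_rev /=.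
apply: leq_trans (leq_addl _ _); rewrite big_nat [leqRHS]big_nat.
apply: leq_sum => i /andP[_ lt_in].
case Eq: (q _) => //=; case Et: (t _) => //=.
by move: (qt _ _ Eq Et) qn; rewrite (_ : _ + _ = n) => [->|]; lia.
Qed.

Lemma double_bin2 n : 2 * 'C(n, 2) + n = n * n.
Proof.
by case: n => // n; have := mul_bin_diag n.+1 1; rewrite bin1 /= => <-; rewrite -mulnSr.
Qed.

(** A least gap [n > 2k] has [k] gaps and [n - k] elements of [t] below it, and [nb_shift_gaps]
    gives [n - k <= k + 1]. Only [n = 2k + 1] survives, and that number lies in [t]. *)
Lemma gaps_bounded (t : pred nat) k :
  (forall y z, t y -> t z -> t (y + z)) ->
  nb (predC t) k.*2.+1 = k -> t k.*2.+1 -> forall n, k.*2 < n -> t n.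
Proof.
move=> tD nbk tk; apply: ltn_ind => n IHn lt_kn; apply: contraT => tn.
have: nb (predC t) n = k.
  rewrite -{}nbk -(subnKC lt_kn) /nb iotaD count_cat -[RHS]addn0; congr (_ + _).
  apply/eqP; rewrite -leqn0 leqNgt -has_count; apply/hasPn => i.
  by rewrite mem_iota negbK => ?; apply: IHn; lia.
have [n_eq|] := eqVneq n k.*2.+1; first by rewrite n_eq tk in tn.
by have := nb_shift_gaps tD tn; have := nbC t n; rewrite nbS /=; lia.
Qed.

(** The element [0] of [t] lies below every gap, so each gap adds at least [1] to the second sum of
    [sum_nb_predC]. *)
Lemma sum_gaps_ge (t : pred nat) n :
  t 0 -> 'C((nb (predC t) n).+1, 2) <= \sum_(0 <= i < n | predC t i) i.
Proof.
move=> t0; rewrite sum_nb_predC binS bin1 leq_add2l /nb -sum1_count.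
rewrite {1}/index_iota subn0 [leqRHS]big_mkcond [leqLHS]big_mkcond.
apply: leq_sum => i _ /=; case: ifP => //= ti.
by apply: (@nb_pos _ 0); rewrite /= ?t0 //; case: i ti; rewrite ?t0.
Qed.

(** By [nb_shift_gaps] at most [j] elements of [t] lie below the [j]-th gap, which is thus at most
    [2j - 1]; these odd numbers sum to a square. *)
Lemma sum_gaps_le (t : pred nat) n :
  (forall y z, t y -> t z -> t (y + z)) ->
  \sum_(0 <= i < n | predC t i) i <= nb (predC t) n ^ 2.
Proof.
move=> tD; rewrite sum_nb_predC; set b := nb _ n.
suff: \sum_(0 <= i < n | predC t i) nb (predC (predC t)) i <= 'C(b.+1, 2).
  by rewrite -[_ ^ 2]/(b * b); have := double_bin2 b; have := double_bin2 b.+1; lia.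
rewrite -sum_nb_succ; apply: leq_sum => i ti.
by rewrite nb_predCK; exact: nb_shift_gaps ti.
Qed.

(* [c] plays the role of the largest element outside [m]. *)
Lemma sum_shifted_gaps_le (t m : pred nat) n c :
  (forall i, nb (predC t) i <= n) ->
  (forall y z, m y -> t z -> m (y + z)) -> (exists i, m i) -> ~~ m c ->
  \sum_(0 <= i < c | predC m i) i <= 'C(nb (predC m) c, 2) + 'C(n, 2).
Proof.
move=> tn mD m_ex mc; rewrite sum_nb_predC leq_add2l.
have [m0 mm0 m0_min] := ex_minnP m_ex.
have nb0 i : i <= m0 -> nb m i = 0.
  move=> le_i; apply/eqP; rewrite -leqn0 leqNgt -has_count; apply/hasPn => j.
  rewrite mem_iota /= => lt_ji; apply/negP => /m0_min; lia.
under eq_bigr do rewrite nb_predCK.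
have [le_c|lt_c] := leqP c m0.
  rewrite big_nat_cond big1 // => i /andP[lt_i _]; apply: nb0; lia.
have -> : c = m0 + (c - m0) by lia.
set d := c - m0; have dt : ~~ t d.
  apply: contra mc => td; rewrite (_ : c = m0 + d); [exact: mD | lia].
rewrite (big_cat_nat (n := m0)) ?leq_addr //=.
rewrite big_nat_cond big1 ?add0n; last by move=> i ?; apply: nb0; lia.
have -> : \sum_(m0 <= i < m0 + d | ~~ m i) nb m i =
    \sum_(0 <= i < d | ~~ m (m0 + i)) nb m (m0 + i).
  rewrite -{1}[m0]add0n big_addn addKn.
  by apply: eq_big => [i|i _]; rewrite addnC.
apply: (@leq_trans (\sum_(0 <= i < d | predC t i) nb (predC t) i.+1)).
  rewrite big_mkcond [leqRHS]big_mkcond; apply: leq_sum => i _ /=.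
  case: ifP => // mi; have ti : ~~ t i by apply: contra mi; apply: mD.
  rewrite ti {1}/nb iotaD count_cat add0n -[count _ (iota 0 m0)]/(nb _ m0) nb0 // add0n.
  rewrite -[m0 in iota m0]addn0 iotaDl count_map.
  apply: (@nb_shift_gaps (fun j => m (m0 + j))) => // y z my tz.
  by rewrite addnA; apply: mD.
(* Since [d] is itself a gap of [t], at most [n - 1] gaps lie below it; this gives ['C(n, 2)]
   instead of ['C(n.+1, 2)]. *)
rewrite sum_nb_succ; apply: leq_bin2l.
by have := tn d.+1; rewrite nbS /= dt addn1.
Qed.

(** * Genus and K-weight expressed by counts and sums of gaps *)

Lemma card_fset_set_nb (A : set nat) (p : pred nat) n :
  (forall i, A i <-> p i /\ i < n) -> #|` fset_set A| = nb p n.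
Proof.
move=> Ap; rewrite /nb -size_filter; apply: perm_size.
have finA : finite_set A.
  by apply: sub_finite_set (finite_II n) => i /Ap[].
apply: uniq_perm; rewrite ?fset_uniq ?filter_uniq ?iota_uniq // => i.
rewrite in_fset_set // mem_filter mem_iota /= add0n.
by apply/idP/andP; rewrite in_setE => /Ap.
Qed.

Section Gaps.

Variables (S : set nat) (l : nat).
Hypotheses (Sl : l \notin S) (l_max : forall i, l < i -> i \in S).

Let gapp : pred nat := fun i => i \notin S.

Lemma gapsE : gaps S = rcons [seq i <- iota 0 l | gapp i] l.
Proof.
have -> : rcons [seq i <- iota 0 l | gapp i] l = [seq i <- iota 0 l.+1 | gapp i].
  by rewrite -addn1 iotaD filter_cat /= /gapp Sl cats1.
rewrite /gaps; apply: (sorted_eq leq_trans anti_leq).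
- exact: sort_sorted leq_total _.
- by rewrite (sorted_filter leq_trans) ?iota_sorted.
have finC : finite_set (~` S)%classic.
  apply: sub_finite_set (finite_II l.+1) => i /= Si; rewrite ltnS leqNgt.
  by apply/negP => /l_max; rewrite in_setE.
rewrite perm_sort; apply: uniq_perm; rewrite ?fset_uniq ?filter_uniq ?iota_uniq // => i.
rewrite in_fset_set // in_setC mem_filter mem_iota /= add0n ltnS.
by case: leqP => [_|/l_max Si]; rewrite ?andbT ?andbF /gapp ?Si.
Qed.

Lemma genusE : genus S = (nb gapp l).+1.
Proof. by rewrite /genus -(size_sort leq) -/(gaps S) gapsE size_rcons size_filter. Qed.

(** With [b = g - 1], the indices sum to ['C(b, 2) + b], and the term [g - 1] of the K-weight
    cancels [b]. *)
Lemma KweightE :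
  (Kweight S + ('C(nb gapp l, 2))%:Z = (\sum_(0 <= i < l | gapp i) i)%N%:Z)%R.
Proof.
rewrite /Kweight genusE; set b := nb _ _.
have -> : (\sum_(0 <= i < l | gapp i) i)%N = \sum_(1 <= i < b.+1) gap S i.
  rewrite big_add1 /= -big_filter /index_iota subn0.
  rewrite (big_nth 0) size_filter -/(nb _ _) -/b.
  rewrite big_nat [RHS]big_nat; apply: eq_bigr => i /= lt_i.
  by rewrite /gap gapsE nth_rcons size_filter -/(nb _ _) -/b lt_i.
have -> : (\sum_(1 <= i < b.+1) ((gap S i)%:Z - i%:Z) =
   (\sum_(1 <= i < b.+1) gap S i)%N%:Z - ('C(b, 2) + b)%N%:Z)%R.
  elim: b => [|b IHb]; first by rewrite !big_geq.
  rewrite !(big_nat_recr b.+1) //= IHb binS bin1; lia.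
lia.
Qed.

End Gaps.

(** * The largest gap, and the small elements of a hyperelliptic semigroup *)

Lemma max_gap (S : set nat) i :
  finite_set (~` S)%classic -> i \notin S ->
  exists2 l, l \notin S & forall j, l < j -> j \in S.
Proof.
move=> finC Si; have gap_fset j : j \notin S -> j \in fset_set (~` S)%classic.
  by rewrite in_fset_set // in_setC.
have gap_le j : j \notin S -> j <= \max_(x <- fset_set (~` S)%classic) x.
  by move=> /gap_fset jC; exact: (@leq_bigmax_seq _ _ xpredT id).
have ex_gap : exists j, j \notin S by exists i.
case: (ex_maxnP ex_gap gap_le) => l Sl l_max.
exists l => // j; rewrite ltnNge; apply: contraR; exact: l_max.
Qed.

(** The [gamma] even elements in [[2, 4 gamma]] and [4 gamma + 2] already exhaust the first
    [gamma + 1] positive elements, so no odd element is smaller. *)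
Lemma hyperelliptic_even_odd gamma (S : set nat) :
  0 \in S -> hyperelliptic gamma S ->
  [/\ nb (fun t => t.*2 \notin S) gamma.*2.+1 = gamma,
      gamma.*2.+1.*2 \in S & forall c, c <= gamma.*2 -> c.*2.+1 \notin S].
Proof.
move=> S0 [even_card [S4 _ card4]].
have S4' : gamma.*2.+1.*2 \in S.
  by rewrite (_ : _.*2 = 4 * gamma + 2); [rewrite in_setE | lia].
pose s' i := (0 < i) && (i \in S).
pose t i := i.*2 \in S.
have t'E : nb (fun i => s' i.*2) gamma.*2.+1 = gamma.
  rewrite -[RHS]even_card.
  have := @card_fset_set_nb [set n | [/\ S n, ~~ odd n & 2 <= n <= 4 * gamma]]%classic
    (fun i => s' i && ~~ odd i) gamma.*2.+1.*2.
  rewrite nb_parity => -> => [|i /=].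
    rewrite [X in _ + X](_ : _ = 0) ?addn0.
      by apply: eq_count => i /=; rewrite odd_double andbT.
    apply/eqP; rewrite -leqn0 leqNgt -has_count; apply/hasPn => i _ /=.
    by rewrite odd_double /= andbF.
  rewrite /s' /= -[S i]in_setE; split.
    by case=> -> -> ?; rewrite !andbT; split; lia.
  by case=> /andP[/andP[? ->] ?] ?; split=> //; lia.
(* [nb_parity] needs an even bound, so [4 gamma + 3], about which nothing is known, is counted on
   both sides. *)
have nb_s' : nb s' gamma.*2.+2.*2 = gamma.+1 + s' gamma.*2.+1.*2.+1.
  rewrite -[gamma.*2.+2.*2]/(gamma.*2.+1.*2.+2) nbS -[in RHS]card4; congr (_ + _).
  apply/esym/card_fset_set_nb => i /=; rewrite /s' -[S i]in_setE.
  by split=> [[-> ?]|[/andP[? ->] ?]]; split; rewrite ?andbT //; lia.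
have odd0 : nb (fun i => s' i.*2.+1) gamma.*2.+1 = 0.
  move: nb_s'; rewrite nb_parity nbS [in X in _ + X = _]nbS t'E.
  by rewrite {1}/s' /= S4'; lia.
split=> // [|c le_c].
  have := nbC t gamma.*2.+1.
  have -> : nb t gamma.*2.+1 = (nb (fun i => s' i.*2) gamma.*2.+1).+1.
    rewrite !nb_sum !(big_nat_recl gamma.*2) //= /t /s' /= S0 add1n; congr _.+1.
  rewrite t'E -[nb (predC t) _]/(nb (fun t => t.*2 \notin S) _); lia.
apply/negP => Sc; have := @nb_pos (fun i => s' i.*2.+1) c gamma.*2.+1.
by rewrite odd0 /s' /= Sc ltnS le_c => /(_ isT isT).
Qed.

(** * Assembling both bounds from the even and odd gaps *)

Theorem theorem2p1 (gamma : nat) (S : set nat)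
    (hS : numerical_semigroup S)
    (hgamma : hyperelliptic gamma S)
    (hg : (2 * gamma + 1 <= genus S)%N) :
  (('C(genus S - 2 * gamma, 2) + 2 * gamma)%N%:Z <= Kweight S)%R /\
  (Kweight S <= ('C(genus S - 2 * gamma, 2) + 2 * gamma ^ 2)%N%:Z)%R.
Proof.
case: hS => S0 SD finC; move/mem_set: S0 => S0.
have {}SD i j : i \in S -> j \in S -> i + j \in S by rewrite !in_setE; exact: SD.
have [t_nb t_max odd_gap] := hyperelliptic_even_odd S0 hgamma.
pose t i := i.*2 \in S; pose m i := i.*2.+1 \in S.
have tD y z : t y -> t z -> t (y + z) by rewrite /t doubleD; exact: SD.
have mD y z : m y -> t z -> m (y + z) by rewrite /m /t doubleD -addSn; exact: SD.
have t_big := gaps_bounded tD t_nb t_max.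
have [l Sl l_max] := max_gap finC (odd_gap _ (leqnn _)).
have lt_l : gamma.*2.*2 < l.
  by rewrite ltnNge; apply: contra (odd_gap _ (leqnn _)) => le_l; apply: l_max; lia.
(* An even [l] would have its half above [2 gamma], hence in [t]. *)
have [c l_eq] : exists c, l = c.*2.+1.
  exists l./2; rewrite -[LHS]odd_double_half.
  case: (odd l) (odd_double_half l) => //= l_even.
  have /t_big : gamma.*2 < l./2 by lia.
  by rewrite /t -[_.*2]add0n l_even (negPf Sl).
subst l; have le_c : gamma.*2 <= c by lia.
have tC n : gamma.*2 < n -> nb (predC t) n = gamma.
  rewrite -[RHS]t_nb; apply: nb_stable => i /t_big; by rewrite /= negbK.
have nb_gap : nb (fun i => i \notin S) c.*2.+1 = gamma + nb (predC m) c.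
  have := nb_parity (fun i => i \notin S) c.+1.
  rewrite doubleS nbS -[nb (fun i => i.*2 \notin S) _]/(nb (predC t) c.+1) tC //.
  rewrite -[nb (fun i => i.*2.+1 \notin S) _]/(nb (predC m) c.+1) [nb _ c.+1]nbS.
  by rewrite /= /m Sl !addn1 addnS => -[].
have sum_gap : \sum_(0 <= i < c.*2.+1 | i \notin S) i =
    (\sum_(0 <= i < c.+1 | predC t i) i).*2 +
    (\sum_(0 <= i < c | predC m i) i).*2 + nb (predC m) c.
  have := sum_parity (fun i => i \notin S) id c.
  rewrite !sum_nat_condS => ->; rewrite -/(predC t c).
  have -> : \sum_(0 <= i < c | i.*2.+1 \notin S) i.*2.+1 =
      (\sum_(0 <= i < c | predC m i) i).*2 + nb (predC m) c.
    rewrite -muln2 big_distrl /nb -sum1_count /index_iota subn0 -big_split /=.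
    by apply: eq_bigr => i _; lia.
  have -> : \sum_(0 <= i < c | i.*2 \notin S) i.*2 =
      (\sum_(0 <= i < c | predC t i) i).*2.
    by rewrite -muln2 big_distrl /=; apply: eq_bigr => i _; rewrite muln2.
  by rewrite /= /t; case: (_ \in S) => /=; lia.
have := KweightE Sl l_max; rewrite (genusE Sl l_max) in hg *.
rewrite {}sum_gap {}nb_gap in hg *; set a := nb _ c in hg *.
have t_ge := @sum_gaps_ge t c.+1 S0.
have t_le := @sum_gaps_le t c.+1 tD.
have m_ge : 'C(a, 2) <= \sum_(0 <= i < c | predC m i) i.
  by rewrite sum_nb_predC leq_addr.
have m_le : \sum_(0 <= i < c | predC m i) i <= 'C(a, 2) + 'C(gamma, 2).
  apply: sum_shifted_gaps_le mD _ Sl; last first.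
    by exists c.+1; apply: l_max; lia.
  move=> i; have [/tC ->//|le_i] := ltnP gamma.*2 i.
  by rewrite -t_nb; apply: leq_nb; lia.
rewrite tC // in t_ge t_le; move=> K_eq.
(* The genus is [gamma + a + 1], so [hg] says [gamma <= a]; using [d] avoids truncated
   subtraction. *)
have [d a_eq] : exists d, a = gamma + d by exists (a - gamma); lia.
rewrite (_ : (gamma + a).+1 - 2 * gamma = d.+1); last lia.
have bin_eq : 'C(d.+1, 2) + 'C(gamma + a, 2) + gamma =
    2 * 'C(a, 2) + a + gamma * gamma.
  have := double_bin2 (gamma + a); have := double_bin2 a.
  have := double_bin2 d.+1; rewrite a_eq; lia.
(* By [bin_eq], the K-weight is ['C(d.+1, 2) + gamma - gamma ^ 2] plus twice the sum over [t] and
   twice the excess of the sum over [m] above ['C(a, 2)]. *)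
have := double_bin2 gamma; have := double_bin2 gamma.+1.
rewrite -[gamma ^ 2]/(gamma * gamma) in t_le *; lia.
Qed.
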